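(* Let $G\cong G_1\times G_2\times\ldots\times G_k$ be a finite abelian group, where $k\geq 1$ is an integer, $p_1,\ldots,p_k$ are distinct primes, and for each $i\in\{1,2,\ldots,k\}$, $G_i\cong C_{p_i^{\alpha_{i1}}}\times C_{p_i^{\alpha_{i2}}}\times\ldots\times C_{p_i^{\alpha_{iv_i}}}$ is the Sylow $p_i$-subgroup of $G$ (with $v_i\geq 1$ and $\alpha_{ij}$ positive integers). Let $n$ be a positive integer and let $L$ be a non-empty subset of $G$. Then $$|N_{n,L}|\in\bigg\{0,\ \bigg[2^{\prod\limits_{i=1}^k\prod\limits_{j=1}^{v_i}(n, p_i^{\alpha_{ij}})}-1\bigg]^{|L|}\bigg\}.$$ In particular, if $|N_{n,L}|\neq 0$, then $|N_{n,L}|$ divides $|\mathcal{P}^*(G)|^{|L|}$.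
   Context: For a set $A$, $\mathcal{P}^*(A)$ denotes the set of all non-empty subsets of $A$ (so $|\mathcal{P}^*(G)|=2^{|G|}-1$ for finite $G$). For $S\in\mathcal{P}^*(G)$ and a positive integer $n$, put $\mho^{\{n\}}(S)=\{s^n \mid s\in S\}$. For $L\in\mathcal{P}^*(G)$, $N_{n,L}$ denotes the set of all $S\in\mathcal{P}^*(G)$ such that $\mho^{\{n\}}(S)=L$. $C_m$ denotes the cyclic group of order $m$, and $(a,b)$ denotes the greatest common divisor of positive integers $a,b$. *)

(* Defs.v *)
From mathcomp Require Import all_boot all_algebra all_fingroup all_solvable.

Set Implicit Arguments.
Unset Strict Implicit.
Unset Printing Implicit Defensive.

Local Open Scope group_scope.

Definition nonempty_subsets (gT : finGroupType) (A : {set gT}) : {set {set gT}} :=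
  powerset A :\ set0.

(* Only the set of n-th powers: unlike 'Mho^n(_), no subgroup is generated
   and n is the exponent itself rather than the exponent of a prime. *)
Definition power_set_of (gT : finGroupType) (n : nat) (S : {set gT}) : {set gT} :=
  [set s ^+ n | s in S].

Definition power_preimages (gT : finGroupType) (G : {set gT}) (n : nat)
    (L : {set gT}) : {set {set gT}} :=
  [set S in nonempty_subsets G | power_set_of n S == L].

(* Main.v *)
(** The map [x |-> x ^+ n] is an endomorphism of the abelian group [G], so each
    of its fibres is empty or a coset of its kernel ['Ldiv_n(G)].  A set [S] with
    [n]-th powers [L] amounts to a choice of a nonempty subset of the fibre over
    each [l] in [L], which gives the count [(2 ^ #|'Ldiv_n(G)| - 1) ^ #|L|] as
    soon as all these fibres are nonempty.  The kernel of a direct product is the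
    product of the kernels, and in a cyclic group of order [m] it has
    [gcdn n m] elements.  The divisibility holds because [#|'Ldiv_n(G)|] divides
    [#|G|] by Lagrange, and [a %| b] implies [2 ^ a - 1 %| 2 ^ b - 1]. *)
Require Import Defs.
From mathcomp Require Import all_boot all_algebra all_fingroup all_solvable.

Set Implicit Arguments.
Unset Strict Implicit.
Unset Printing Implicit Defensive.

Lemma dvdn_expB1 m a b : a %| b -> m ^ a - 1 %| m ^ b - 1.
Proof.
by case/dvdnP=> c ->; rewrite mulnC expnM !subn1 (predn_exp (m ^ a)) dvdn_mulr.
Qed.

Lemma card_powersetD0 (T : finType) (A : {set T}) :
  #|powerset A :\ set0| = 2 ^ #|A| - 1.
Proof.
have := cardsD1 set0 (powerset A).
by rewrite powersetE sub0set card_powerset => ->; rewrite addKn.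
Qed.

(** A set is determined by its traces on the fibres of [f]; the map [h] records these traces, which
    turns the count into one of families of sets. *)
Lemma card_sets_with_image (T U : finType) (f : T -> U) (A : {set T}) (L : {set U}) :
  #|[set S in powerset A | f @: S == L]| =
  \prod_(l in L) (2 ^ #|[set x in A | f x == l]| - 1).
Proof.
pose fib l := [set x in A | f x == l].
pose D := [set S in powerset A | f @: S == L].
pose h (S : {set T}) : {ffun U -> {set T}} := [ffun l => [set x in S | f x == l]].
have h_inj : injective h.
  move=> S S' /ffunP eqh; apply/setP=> x.
  by have /setP/(_ x) := eqh (f x); rewrite !ffunE !inE eqxx !andbT.
(* The default value [set0] off [L] says that no point of [S] is sent outside [L]; nonempty values
   on [L] say that all of [L] is reached. *)
transitivity #|pfamily set0 L (fun l => powerset (fib l) :\ set0)|; last first.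
  rewrite card_pfamily -big_enum /= /image_mem.
  by elim: (enum L) => [|l s IHs]; rewrite ?big_nil // big_cons -IHs /= card_powersetD0.
rewrite -(card_imset _ h_inj); apply: eq_card => g.
apply/imsetP/pfamilyP => [[S] | [/subsetP supp_g g_fib]].
  rewrite !inE => /andP[/subsetP SA /eqP fS] ->; split.
    apply/subsetP=> l; rewrite inE ffunE => /set0Pn[x].
    by rewrite inE -fS => /andP[Sx /eqP <-]; apply: imset_f.
  move=> l Ll; rewrite ffunE !inE; apply/andP; split.
    move: Ll; rewrite -fS => /imsetP[x Sx ->].
    by apply/set0Pn; exists x; rewrite inE Sx eqxx.
  by apply/subsetP=> x; rewrite !inE => /andP[/SA-> ->].
have gP l x : x \in g l -> [/\ l \in L, x \in A & f x = l].
  move=> gx; have Ll : l \in L by apply: supp_g; apply/set0Pn; exists x.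
  have := g_fib l Ll; rewrite !inE => /andP[_ /subsetP/(_ x gx)].
  by rewrite inE => /andP[-> /eqP].
(* The preimage of [g] under [h] is the union of its values, which are disjoint because [g l] lies
   over [l]. *)
exists (\bigcup_l g l).
  rewrite !inE; apply/andP; split.
    by apply/bigcupsP=> l _; apply/subsetP=> x /gP[].
  apply/eqP/setP=> l; apply/imsetP/idP => [[x /bigcupP[l' _ gx] ->] | Ll].
    by have [Ll' _ ->] := gP _ _ gx.
  have := g_fib l Ll; rewrite !inE => /andP[/set0Pn[x gx] _].
  by exists x; [apply/bigcupP; exists l | have [] := gP _ _ gx].
apply/ffunP=> l; apply/setP=> x; rewrite ffunE inE.
apply/idP/andP => [gx | [/bigcupP[l' _ gx] /eqP <-]].
  by split; [apply/bigcupP; exists l | have [_ _ ->] := gP _ _ gx].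
by have [_ _ ->] := gP _ _ gx.
Qed.

Section PowerMap.

Local Open Scope group_scope.

(** Translation by [y] carries the kernel onto the fibre through [y]. *)
Lemma card_expg_fiber (gT : finGroupType) (G : {group gT}) n y :
  abelian G -> y \in G ->
  #|[set x in G | x ^+ n == y ^+ n]| = #|'Ldiv_n(G)|.
Proof.
move=> abG Gy; rewrite -(card_lcoset 'Ldiv_n(G) y); apply: eq_card => x.
rewrite mem_lcoset !inE groupMl ?groupV //; apply: andb_id2l => Gx.
rewrite expgMn; last by apply: (centsP abG); rewrite ?groupV.
by rewrite expVgn -eq_mulVg1 eq_sym.
Qed.

Lemma card_Ldiv_isog (aT rT : finGroupType) (G : {group aT}) (H : {group rT}) n :
  G \isog H -> #|'Ldiv_n(G)| = #|'Ldiv_n(H)|.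
Proof.
case/isogP=> f injf <-; rewrite -injm_Ldiv // card_injm //; exact: subsetIl.
Qed.

(** Evaluation at [i] is a group morphism, so it commutes with powers. *)
Lemma dffun_expg (I : finType) (gT : I -> finGroupType)
    (x : {dffun forall i, gT i}) n i : (x ^+ n) i = x i ^+ n.
Proof. exact: (morphX (dffun_morphism gT i) n (in_setT x)). Qed.

Lemma card_Ldiv_setXn (I : finType) (gT : I -> finGroupType)
    (A : forall i, {set gT i}) n :
  #|'Ldiv_n(setXn A)| = (\prod_i #|'Ldiv_n(A i)|)%N.
Proof.
rewrite -cardsXn; apply: eq_card => x; rewrite in_setI in_setXn inE.
apply/andP/setXnP => [[/forallP xA /eqP xn1] i | xAn].
  by rewrite inE xA inE -dffun_expg xn1 ffunE eqxx.
split; first by apply/forallP=> i; have /LdivP[] := xAn i.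
by apply/eqP/ffunP=> i; rewrite dffun_expg ffunE; have /LdivP[] := xAn i.
Qed.

(** Divisibility holds both ways. The kernel is cyclic, so its order is its exponent, which divides
    [n]. Conversely, it contains an element of order [d], a suitable power of a generator. *)
Lemma card_Ldiv_cyclic (gT : finGroupType) (G : {group gT}) n :
  cyclic G -> #|'Ldiv_n(G)| = gcdn n #|G|.
Proof.
move=> cycG; have abG := cyclic_abelian cycG.
pose K := Group (group_Ldiv n abG); pose d := gcdn n #|G|.
have sKG : K \subset G by apply: subsetIl.
apply/eqP; rewrite eqn_dvd -/d; apply/andP; split.
  rewrite -[#|_|](exponent_cyclic (cyclicS sKG cycG)) dvdn_gcd.
  rewrite -sub_LdivT subsetIr /=.
  exact: dvdn_trans (exponent_dvdn K) (cardSg sKG).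
case/cyclicP: (cycG) => x defG.
have dvdx : d %| #[x] by rewrite /order -defG dvdn_gcdr.
have <- : #[x ^+ (#[x] %/ d)] = d.
  by rewrite orderXdiv ?divnA ?mulKn ?dvdn_div // order_gt0.
apply: (@order_dvdG _ K); rewrite !inE defG mem_cycle /= -expgM.
(* Cancelling [#[x] %/ d] leaves [d %| n]. *)
rewrite -order_dvdn -{1}(divnK dvdx) dvdn_pmul2l ?(dvdn_gcdl n #|G|) //.
by rewrite divn_gt0 ?(dvdn_leq (order_gt0 x)) // gcdn_gt0 cardG_gt0 orbT.
Qed.

Lemma cyclic_Zp m : cyclic (Zp m).
Proof.
(* For [m <= 1] the type ['Z_m] still has two elements, and [Zp m] is the trivial group by
   definition. *)
rewrite /Zp; case: (1 < m)%N; last exact: cyclic1.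
by apply/cyclicP; exists Zp1; exact: Zp_cycle.
Qed.

End PowerMap.

Lemma power_preimagesE (gT : finGroupType) (G L : {set gT}) n :
  L != set0 ->
  power_preimages G n L =
    [set S in powerset G | (fun x => x ^+ n)%g @: S == L].
Proof.
move=> L0; apply/setP=> S; rewrite !inE; apply: andb_id2r => /eqP fS.
suff -> : S != set0 by [].
by apply: contraNneq L0 => S0; rewrite -fS S0 /power_set_of imset0.
Qed.

Lemma card_power_preimages (gT : finGroupType) (G : {group gT}) (L : {set gT}) n :
  abelian G -> L != set0 ->
  #|power_preimages G n L| =
    if L \subset power_set_of n G then (2 ^ #|'Ldiv_n(G)%g| - 1) ^ #|L| else 0.
Proof.
move=> abG L0; rewrite power_preimagesE // card_sets_with_image.
case: ifPn => [/subsetP sLG | /subsetPn[l Ll nGl]].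
  rewrite -prod_nat_const; apply: eq_bigr => l /sLG/imsetP[y Gy ->].
  by rewrite card_expg_fiber.
(* The fibre over [l] is empty, and its factor [2 ^ 0 - 1] annihilates the product. *)
rewrite (bigD1 l) //= (_ : [set _ in _ | _] = set0) ?cards0 //.
apply: contraNeq nGl => /set0Pn[x]; rewrite inE => /andP[Gx /eqP <-].
exact: imset_f.
Qed.

Theorem theorem2p6 (gT : finGroupType) (G : {group gT})
    (k : nat) (p : 'I_k -> nat) (Gs : 'I_k -> {group gT})
    (v : 'I_k -> nat) (alpha : forall i : 'I_k, 'I_(v i) -> nat)
    (n : nat) (L : {set gT}) :
  abelian G ->
  0 < k ->
  (forall i, prime (p i)) ->
  injective p ->
  (forall i, 0 < v i) ->
  (forall i (j : 'I_(v i)), 0 < alpha i j) ->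
  (forall i, ((p i).-Sylow(G) (Gs i))%g) ->
  (G \isog setXn (fun i : 'I_k => Gs i : {set gT}))%g ->
  (forall i,
    (Gs i \isog setXn (fun j : 'I_(v i) => Zp (p i ^ alpha i j)%N))%g) ->
  0 < n ->
  L \in nonempty_subsets G ->
  (#|power_preimages G n L| = 0 \/
   #|power_preimages G n L| =
     (2 ^ (\prod_(i < k) \prod_(j < v i) gcdn n (p i ^ alpha i j)) - 1) ^ #|L|)
  /\
  (#|power_preimages G n L| <> 0 ->
   #|power_preimages G n L| %| #|nonempty_subsets G| ^ #|L|).
Proof.
move=> abG _ p_pr _ _ _ _ isoG isoGs _ /setD1P[L0 _].
have <- : #|'Ldiv_n(G)%g| = \prod_(i < k) \prod_(j < v i) gcdn n (p i ^ alpha i j).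
  rewrite (card_Ldiv_isog n isoG) card_Ldiv_setXn; apply: eq_bigr => i _.
  rewrite (card_Ldiv_isog n (isoGs i)) card_Ldiv_setXn; apply: eq_bigr => j _.
  by rewrite (card_Ldiv_cyclic _ (cyclic_Zp _)) card_Zp ?expn_gt0 ?prime_gt0.
rewrite card_power_preimages //; case: ifP => _; last by split; [left|].
split; [by right | move=> _].
rewrite card_powersetD0 dvdn_exp2r // dvdn_expB1 //.
exact: (@cardSg _ G (Group (group_Ldiv n abG)) (subsetIl _ _)).
Qed.
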